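(* Let $n\ge3$ and let $P\in\mathcal M_n$ be a fully pinned configuration such that $W(P)$ contains no nonzero decomposable tensor $h\otimes u$ ($h\in H_0(P)$, $u\in\mathbb R^2$). Then the simultaneous conditions $$\dim H_0(P)=2,\qquad \dim W(P)=2$$ are impossible.
   Context: A configuration is $P=(p_1,\dots,p_n)$ with $p_i=(x_i,y_i)\in[0,1]^2$. For a triple $t=(i,j,k)$, $i<j<k$, put $D_t(P)=\det(p_j-p_i,p_k-p_i)$, $A_t(P)=\tfrac12|D_t(P)|$, $\delta(P)=\min_tA_t(P)$, $\Delta_n=\max_P\delta(P)>0$, and $\mathcal M_n=\{P\in([0,1]^2)^n:\delta(P)=\Delta_n\}$. Fix $P\in\mathcal M_n$. Triangle $t$ is tight if $A_t(P)=\Delta_n$. Put $s_t=\operatorname{sgn}D_t(P)$; near $P$, $A_t=\tfrac12s_tD_t$, which is used for derivatives. Fully pinned: for $i\in[n]$, the one-point feasible polyhedron at $i$ is the set of $(p,\tau)\in\mathbb R^2\times\mathbb R$ such that $p\in[0,1]^2$ and $\tfrac12s_tD_t(P')\ge\tau$ for all triples $t$, where $P'$ is $P$ with $p_i$ replaced by $p$ (signs $s_t$ fixed from $P$). $P$ is fully pinned if $(p_i,\Delta_n)$ is a vertex of its one-point feasible polyhedron for every $i$. A normalized KKT multiplier at $P$ is a tuple $q=(\lambda,\ell,r,d,u)$ of nonnegative reals $\lambda_t$ (all triples $t$), $\ell_i,r_i,d_i,u_i$ ($i\in[n]$) with: $\lambda_t=0$ unless $t$ is tight; $\ell_i=0$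 unless $x_i=0$, $r_i=0$ unless $x_i=1$, $d_i=0$ unless $y_i=0$, $u_i=0$ unless $y_i=1$; $\sum_t\lambda_t=1$; and $\sum_t\lambda_t\nabla_{p_i}A_t(P)+(\ell_i-r_i,d_i-u_i)=0$ for all $i$. Their set is $\mathcal K(P)$. For $t=(i,j,k)$, $i<j<k$, let $B_t=s_t(a_tc_t^T-c_ta_t^T)\in\mathbb R^{n\times n}$, $a_t=e_j-e_i$, $c_t=e_k-e_i$, and $B(q)=\sum_t\lambda_tB_t$. The shared kernel is $K_{\mathrm{sh}}=\bigcap_{q\in\mathcal K(P)}\ker B(q)$; it contains the all-ones vector $\mathbf 1$. Put $H_0(P)=K_{\mathrm{sh}}/\langle\mathbf 1\rangle$. Velocities are $v=(\xi,\eta)\in\mathbb R^n\oplus\mathbb R^n$, $v_i=(\xi_i,\eta_i)$. $J^{\mathrm{tr}}_{\mathrm{tight}}$ is the linear map with rows: $v\mapsto DA_t(P)[v]$ for all tight $t$; $v\mapsto\xi_i-\xi_j$ for all $i,j$ with $x_i,x_j\in\{0,1\}$; $v\mapsto\eta_i-\eta_j$ for all $i,j$ with $y_i,y_j\in\{0,1\}$. With $T_{\mathrm{tr}}=\operatorname{span}\{(\mathbf 1,0),(0,\mathbf 1)\}$, put $$W(P)=\frac{(K_{\mathrm{sh}}\oplus K_{\mathrm{sh}})\cap\ker J^{\mathrm{tr}}_{\mathrm{tight}}}{T_{\mathrm{tr}}}\subset H_0\oplus H_0=H_0\otimes\mathbb R^2,$$ where $h\otimes u$ corresponds to $(u_1h,u_2h)$,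 i.e. to the velocity $v_i=h_iu$ modulo translations. *)

(* Defs.v *)
From HB Require Import structures.
From mathcomp Require Import all_boot all_order all_algebra.
From mathcomp Require Import all_classical all_reals all_analysis.
Import Order.TTheory GRing.Theory Num.Theory.
Import numFieldNormedType.Exports.

Set Implicit Arguments.
Unset Strict Implicit.
Unset Printing Implicit Defensive.

Local Open Scope classical_set_scope.
Local Open Scope ring_scope.

Section LinearAlgebra.
Variables (K : fieldType) (vT : vectType K).

Lemma bigcapv_exists (I : Type) (A : set I) (F : I -> {vspace vT}) :
  exists U : {vspace vT}, forall v, v \in U <-> (forall i, A i -> v \in F i).
Proof.
suff H d : forall U : {vspace vT}, (\dim U <= d)%N ->
    (forall v, (forall i, A i -> v \in F i) -> v \in U) ->
    exists U : {vspace vT}, forall v, v \in U <-> (forall i, A i -> v \in F i).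
  by apply: (H (\dim {:vT}) fullv) => // v _; apply: memvf.
elim: d => [|d IHd] U dU sU.
  exists U => v; split; last exact: sU.
  move: dU; rewrite leqn0 dimv_eq0 => /eqP ->; rewrite memv0 => /eqP -> i _.
  exact: mem0v.
have [[i [Ai nUi]]|nex] := pselect (exists i, A i /\ ~~ (U <= F i)%VS).
  apply: (IHd (U :&: F i)%VS); last first.
    by move=> v vF; rewrite memv_cap sU ?vF.
  rewrite -ltnS; apply: leq_trans dU.
  rewrite ltn_neqAle dimvS ?capvSl// andbT; apply: contra nUi => /eqP dE.
  by apply/capv_idPl/eqP; rewrite eqEdim capvSl dE leqnn.
exists U => v; split; last exact: sU.
move=> vU i Ai; apply: (subvP _ v vU).
by apply: contrapT => /negP nUi; apply: nex; exists i.
Qed.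

(* Intersection of an arbitrary (possibly infinite) family of subspaces. *)
Definition bigcapv (I : Type) (A : set I) (F : I -> {vspace vT}) :
    {vspace vT} :=
  projT1 (cid (bigcapv_exists A F)).

Lemma mem_bigcapv (I : Type) (A : set I) (F : I -> {vspace vT}) v :
  v \in bigcapv A F <-> (forall i, A i -> v \in F i).
Proof. exact: (projT2 (cid (bigcapv_exists A F))). Qed.

(* The quotient space vT / U, realized on a complement of U; the class of a
   vector is its projection along U (see vclass_eq and limg_vclass). *)
Definition vquot (U : {vspace vT}) : vectType K := subvs_of (U^C)%VS.

Definition vclass (U : {vspace vT}) : 'Hom(vT, vquot U) :=
  (linfun (vsproj (U^C)%VS) \o daddv_pi (U^C)%VS U)%VF.

Definition vrepr (U : {vspace vT}) (c : vquot U) : vT := vsval c.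

Lemma vrepr0 U : vrepr (0 : vquot U) = 0.
Proof. by []. Qed.

Lemma vclassE U v : vrepr (vclass U v) = daddv_pi (U^C)%VS U v.
Proof. by rewrite /vrepr comp_lfunE lfunE /= vsprojK ?memv_pi. Qed.

Lemma vrepr_class U v : v - vrepr (vclass U v) \in U.
Proof.
rewrite vclassE -{1}(@daddv_pi_add _ _ (U^C)%VS U v).
- by rewrite addrC addKr memv_pi.
- by rewrite capvC capv_compl.
- by rewrite addvC addv_complf memvf.
Qed.

Lemma vreprK U : cancel (@vrepr U) (vclass U).
Proof.
move=> c; apply: val_inj; rewrite /= -[LHS]/(vrepr _) vclassE.
by rewrite daddv_pi_id ?subvsP // capvC capv_compl.
Qed.

Lemma lker_vclass U : lker (vclass U) = U.
Proof.
apply/vspaceP => v; rewrite memv_ker; apply/eqP/idP => [v0|vU].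
  by have := vrepr_class U v; rewrite v0 vrepr0 subr0.
apply: val_inj; rewrite -[RHS]/(0 : vT).
have rU : vrepr (vclass U v) \in U.
  by rewrite -[vrepr _](subKr v) rpredB ?vrepr_class.
apply/eqP; rewrite -memv0 -(capv_compl U) memv_cap; apply/andP; split => //.
exact: subvsP.
Qed.

Lemma vclass_eq U v w : (vclass U v == vclass U w) = (v - w \in U).
Proof. by rewrite -subr_eq0 -linearB -memv_ker lker_vclass. Qed.

Lemma limg_vclass U : limg (vclass U) = fullv.
Proof.
apply/vspaceP => c; rewrite memvf; apply/memv_imgP.
by exists (vrepr c); rewrite ?memvf ?vreprK.
Qed.

(* V / U as a subspace of vT / U. *)
Definition quotv (V U : {vspace vT}) : {vspace vquot U} := (vclass U @: V)%VS.

End LinearAlgebra.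

Section Geometry.
Variables (R : realType) (n : nat).

(* A configuration, or a velocity, is an n x 2 matrix: row i is p_i = (x_i, y_i)
   resp. v_i = (xi_i, eta_i), and columns 0 and 1 are x, y resp. xi, eta. *)
Local Notation conf := 'M[R]_(n, 2).
Implicit Types (P Q v : conf) (i j : 'I_n).

Definition vec2 (a b : R) : 'rV[R]_2 := \row_c (if c == 0 then a else b).

Definition triple : Type :=
  {t : 'I_n * 'I_n * 'I_n | (t.1.1 < t.1.2 < t.2)%N}.
HB.instance Definition _ := Finite.on triple.

Definition ti (t : triple) : 'I_n := (val t).1.1.
Definition tj (t : triple) : 'I_n := (val t).1.2.
Definition tk (t : triple) : 'I_n := (val t).2.

Definition Ddet (t : triple) Q : R :=
  \det (col_mx (row (tj t) Q - row (ti t) Q) (row (tk t) Q - row (ti t) Q)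
        : 'M[R]_2).

Lemma det2E (M : 'M[R]_2) : \det M = M 0 0 * M 1 1 - M 0 1 * M 1 0.
Proof.
rewrite (expand_det_row _ 0) !big_ord_recl big_ord0 /cofactor !det_mx11 !mxE.
have l00 : lift ord0 ord0 = 1 :> 'I_2 by exact/val_inj.
have l00' : lift 0 0 = 1 :> 'I_2 by exact/val_inj.
have l10 : lift 1 0 = 0 :> 'I_2 by exact/val_inj.
rewrite !l00 ?l00' ?l10 /= expr0 expr1 mul1r mulN1r mulrN addr0 //.
Qed.

Lemma DdetE (t : triple) Q :
  Ddet t Q = (Q (tj t) 0 - Q (ti t) 0) * (Q (tk t) 1 - Q (ti t) 1)
           - (Q (tj t) 1 - Q (ti t) 1) * (Q (tk t) 0 - Q (ti t) 0).
Proof.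
rewrite /Ddet; set C : 'M[R]_2 := (X in \det X).
pose u := row (tj t) Q - row (ti t) Q; pose w := row (tk t) Q - row (ti t) Q.
have C0 c : C 0 c = Q (tj t) c - Q (ti t) c.
  transitivity (u 0 c); last by rewrite !mxE.
  rewrite -(col_mxEu u w) /C; congr (fun_of_matrix _ _ _); exact/val_inj.
have C1 c : C 1 c = Q (tk t) c - Q (ti t) c.
  transitivity (w 0 c); last by rewrite !mxE.
  rewrite -(col_mxEd u w) /C; congr (fun_of_matrix _ _ _); exact/val_inj.
by rewrite det2E !C0 !C1.
Qed.

Definition area (t : triple) Q : R := 2^-1 * `|Ddet t Q|.

Definition in_square (p : 'rV[R]_2) : Prop := forall c, 0 <= p 0 c <= 1.

Definition in_cube Q : Prop := forall i, in_square (row i Q).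

(* Minimum over the finite, nonempty if 3 <= n, set of triples. *)
Definition delta Q : R := inf [set area t Q | t in [set: triple]].

(* This supremum is a maximum, the cube being compact and delta continuous. *)
Definition Delta : R := sup [set delta Q | Q in in_cube].

Definition maximizers : set conf := [set Q | in_cube Q /\ delta Q = Delta].

Definition tight P (t : triple) : bool := area t P == Delta.

(* The smooth function of Q that coincides with area t Q for Q near P. *)
Definition sarea P (t : triple) Q : R := 2^-1 * Num.sg (Ddet t P) * Ddet t Q.

(* Extreme points; for a polyhedron these are its vertices. *)
Definition vertex (E : lmodType R) (S : set E) (x : E) : Prop :=
  S x /\ forall (a b : E) (l : R), S a -> S b -> 0 < l < 1 ->
    x = l *: a + (1 - l) *: b -> a = x /\ b = x.

Definition replace_pt P i (p : 'rV[R]_2) : conf :=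
  \matrix_(a < n, c < 2) (if a == i then p 0 c else P a c).

Definition one_point_polyhedron P i : set ('rV[R]_2 * R^o)%type :=
  [set z | in_square z.1 /\
           forall t : triple, z.2 <= sarea P t (replace_pt P i z.1)].

Definition fully_pinned P : Prop :=
  forall i, vertex (one_point_polyhedron P i) (row i P, Delta).

Record multiplier := Multiplier {
  mlam : triple -> R;
  mleft : 'I_n -> R;
  mright : 'I_n -> R;
  mdown : 'I_n -> R;
  mup : 'I_n -> R }.

(* Gradient of A_t at P with respect to the point p_i. *)
Definition gradA P (t : triple) i : 'rV[R]_2 :=
  \row_(c < 2) 'D_(delta_mx i c) (sarea P t) P.

Record KKT P (q : multiplier) : Prop := {
  kkt_lam_ge0 : forall t, 0 <= mlam q t;
  kkt_bd_ge0 : forall i, [/\ 0 <= mleft q i, 0 <= mright q i,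
                             0 <= mdown q i & 0 <= mup q i];
  kkt_lam_tight : forall t, ~~ tight P t -> mlam q t = 0;
  kkt_left : forall i, P i 0 != 0 -> mleft q i = 0;
  kkt_right : forall i, P i 0 != 1 -> mright q i = 0;
  kkt_down : forall i, P i 1 != 0 -> mdown q i = 0;
  kkt_up : forall i, P i 1 != 1 -> mup q i = 0;
  kkt_sum : \sum_t mlam q t = 1;
  kkt_stationary : forall i,
    \sum_t mlam q t *: gradA P t i
      + vec2 (mleft q i - mright q i) (mdown q i - mup q i) = 0 }.

Definition evec i : 'cV[R]_n := delta_mx i 0.

Definition Bt P (t : triple) : 'M[R]_n :=
  let a := evec (tj t) - evec (ti t) in
  let c := evec (tk t) - evec (ti t) in
  Num.sg (Ddet t P) *: (a *m c^T - c *m a^T).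

Definition Bq P (q : multiplier) : 'M[R]_n := \sum_t mlam q t *: Bt P t.

Definition Ksh P : {vspace 'cV[R]_n} :=
  bigcapv (KKT P) (fun q => lker (linfun (mulmx (Bq P q)))).

Definition ones : 'cV[R]_n := const_mx 1.

Definition H0 P : {vspace vquot <[ones]>%VS} := quotv (Ksh P) <[ones]>%VS.

Definition on_side (a : R) : bool := (a == 0) || (a == 1).

Lemma differentiable_sarea P t Q : differentiable (sarea P t) Q.
Proof.
have cdiff i (c : 'I_2) : differentiable (fun S : conf => S i c) Q.
  exact: differentiable_coord.
pose a i c := fun S : conf => S i c.
have -> : sarea P t = (2^-1 * Num.sg (Ddet t P)) \*:
    ((a (tj t) 0 - a (ti t) 0) * (a (tk t) 1 - a (ti t) 1)
     - (a (tj t) 1 - a (ti t) 1) * (a (tk t) 0 - a (ti t) 0)).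
  by apply/funext => S; rewrite /sarea (DdetE t S).
apply: differentiableZ; apply: differentiableB; apply: differentiableM;
  apply: differentiableB; exact: cdiff.
Qed.

(* The rows of J indexed by tight triples, by pairs of points on the vertical
   sides, and by pairs of points on the horizontal sides. *)
Definition Jtarget P : vectType R :=
  ({ffun {t : triple | tight P t} -> R^o} *
   {ffun {ij : 'I_n * 'I_n | on_side (P ij.1 0) && on_side (P ij.2 0)} -> R^o} *
   {ffun {ij : 'I_n * 'I_n | on_side (P ij.1 1) && on_side (P ij.2 1)} -> R^o}
  )%type.

Definition Jfun P v : Jtarget P :=
  ([ffun t => 'd (sarea P (val t)) P v],
   [ffun ij => v (val ij).1 0 - v (val ij).2 0],
   [ffun ij => v (val ij).1 1 - v (val ij).2 1]).

Lemma Jfun_is_linear P : linear (Jfun P).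
Proof.
move=> a u v; congr (_, _, _); apply/ffunP => z; rewrite !ffunE.
- exact: linearP.
- by rewrite !mxE /= scalerBr opprD addrACA.
- by rewrite !mxE /= scalerBr opprD addrACA.
Qed.
HB.instance Definition _ P :=
  GRing.isLinear.Build R conf (Jtarget P) _ (Jfun P) (@Jfun_is_linear P).

Definition Jtight P : 'Hom(conf, Jtarget P) := linfun (Jfun P).

(* The velocity v_i = h_i u. *)
Definition velocity (h : 'cV[R]_n) (u : 'rV[R]_2) : conf := h *m u.

Definition Ttr : {vspace conf} :=
  <<[:: velocity ones (vec2 1 0); velocity ones (vec2 0 1)]>>%VS.

(* Ksh (+) Ksh: both columns lie in Ksh. *)
Definition Ksh2 P : {vspace conf} :=
  (\bigcap_(c < 2) linfun (col c) @^-1: Ksh P)%VS.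

Definition W P : {vspace vquot Ttr} := quotv (Ksh2 P :&: lker (Jtight P))%VS Ttr.

(* The tensor h (x) u, for h in R^n / <ones>, as a velocity modulo Ttr; it does
   not depend on the representative of h (see tensorE). *)
Definition tensor (h : vquot <[ones]>%VS) (u : 'rV[R]_2) : vquot Ttr :=
  vclass Ttr (velocity (vrepr h) u).

Lemma tensorE (h : 'cV[R]_n) (u : 'rV[R]_2) :
  tensor (vclass <[ones]>%VS h) u = vclass Ttr (velocity h u).
Proof.
apply/eqP; rewrite vclass_eq /velocity -mulmxBl.
have /vlineP[k E] := vrepr_class <[ones]>%VS h.
rewrite -(opprB h) E -scaleNr -scalemxAl rpredZ //.
have -> : u = u 0 0 *: vec2 1 0 + u 0 1 *: vec2 0 1.
  apply/rowP => c; rewrite !mxE; case: c => -[|[|//]] Hc /=;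
  rewrite mulr1 mulr0 ?addr0 ?add0r; congr (u _ _); exact/val_inj.
rewrite mulmxDr -!scalemxAr rpredD // rpredZ // memv_span // !inE eqxx ?orbT //.
Qed.

End Geometry.

(* Main.v *)
Require Import Defs.
From HB Require Import structures.
From mathcomp Require Import all_boot all_order all_algebra.
From mathcomp Require Import all_classical all_reals all_analysis.
From mathcomp Require Import ring lra zify.
Import Order.TTheory GRing.Theory Num.Theory.
Import numFieldNormedType.Exports.
Local Open Scope classical_set_scope.
Local Open Scope ring_scope.

(* If [W] is a plane without decomposable tensors, it is spanned by a velocity
   [v] and a second one [v *m M], up to translation, where [M] has no real
   eigenvalue.  On a tight triangle [v] is a linear image of [P], say by [N], and
   vanishing first variations along [v] and [v *m M] mean that [N] and [N *m M]
   are traceless; for elliptic [M] this forces [\det N < 0] unless [N = 0].  As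
   [v] lies in the shared kernel, the second variation of every multiplier
   vanishes along [v]; being a sum of terms [<= 0], it vanishes termwise, so [v]
   is constant on every triangle charged by a multiplier.

   The points on sides of a given direction share the same value of [v], and, by
   Euler's identity, a level set of [v] avoiding the sides of one direction
   carries no weight.  Hence a single level set [v = x] contains all side points
   and all charged triangles.  Unit vectors at points outside it lie in the
   three-dimensional shared kernel, so there are at most two such points.  Let
   [p_i] be one of them.  Every tight triangle at [p_i] is [{i, j, k}] with [k]
   the other outside point and [p_j] determined by [N], which is the same for all
   these triangles; moving [p_i] parallel to [p_j - p_k] preserves all tight
   areas, contradicting pinnedness.

   Without multipliers, the shared kernel is everything, so [n = 3] and there is
   a single triangle; pinnedness then puts all points at corners, where [v] is
   constant. *)

Set Implicit Arguments.
Unset Strict Implicit.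
Unset Printing Implicit Defensive.

Lemma forall_ord2 (Q : 'I_2 -> Prop) : Q 0 -> Q 1 -> forall c, Q c.
Proof.
move=> Q0 Q1 [[|[|//]] Hc]; [move: Q0|move: Q1]; congr Q; exact/val_inj.
Qed.

Lemma sum_ord2 (V : nmodType) (F : 'I_2 -> V) : \sum_c F c = F 0 + F 1.
Proof.
rewrite !big_ord_recl big_ord0 addr0; congr (F _ + F _); exact/val_inj.
Qed.

(** * Traceless and elliptic plane matrices *)

Section PlaneMatrices.
Variable R : realType.
Implicit Types M N : 'M[R]_2.

Lemma mul_row2E (e : 'rV[R]_2) N c : (e *m N) 0 c = e 0 0 * N 0 c + e 0 1 * N 1 c.
Proof. by rewrite mxE sum_ord2. Qed.

Lemma mxtrace2E M : \tr M = M 0 0 + M 1 1.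
Proof. by rewrite /mxtrace sum_ord2. Qed.

Lemma mulmx2E M N a c : (M *m N) a c = M a 0 * N 0 c + M a 1 * N 1 c.
Proof. by rewrite mxE sum_ord2. Qed.

Lemma mx2P M N : M 0 0 = N 0 0 -> M 0 1 = N 0 1 -> M 1 0 = N 1 0 ->
  M 1 1 = N 1 1 -> M = N.
Proof. by move=> *; apply/matrixP; do 2!apply: forall_ord2 => //. Qed.

(** The discriminant is [(M 0 0 - M 1 1) ^+ 2 + 4 * M 0 1 * M 1 0], so a negative value forces a
    negative product of the off-diagonal entries. *)
Lemma elliptic_offdiag M : (\tr M) ^+ 2 < 4 * \det M -> M 0 1 != 0 /\ M 1 0 != 0.
Proof.
rewrite mxtrace2E det2E => ell.
suff: M 0 1 * M 1 0 != 0 by rewrite mulf_eq0 negb_or => /andP.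
by apply/eqP => E; have := sqr_ge0 (M 0 0 - M 1 1); nra.
Qed.

(* On the traceless matrices [- det] has signature (2, 1), and it is negative
   at the traceless part of an elliptic [M], hence positive on its orthogonal
   complement for the trace form. *)
Lemma det_trace_orth M N : (\tr M) ^+ 2 < 4 * \det M ->
  \tr N = 0 -> \tr (N *m M) = 0 -> N != 0 -> \det N < 0.
Proof.
move=> ell; have [M01 M10] := elliptic_offdiag ell.
move: ell; rewrite !mxtrace2E !mulmx2E !det2E => ell trN trNM.
rewrite ltNge; apply: contraNN => detN.
set m := M 0 1 in M01 ell trNM; set m' := M 1 0 in ell trNM.
set d := M 0 0 - M 1 1.
have N11 : N 1 1 = - N 0 0 by lra.
have E : N 1 0 * m = - (N 0 0 * d + N 0 1 * m').
  by move: trNM; rewrite N11 /d; lra.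
have disc : d ^+ 2 + 4 * m * m' < 0 by move: ell; rewrite /d; lra.
(* With [N 1 0] eliminated through [E], the left side is [- 4 * m ^+ 2 * \det N]; by [disc] it is
   also a sum of two nonnegative terms, so both vanish. *)
have key : (2 * m * N 0 0 - N 0 1 * d) ^+ 2
    - N 0 1 ^+ 2 * (d ^+ 2 + 4 * m * m') <= 0.
  have -> : (2 * m * N 0 0 - N 0 1 * d) ^+ 2
      - N 0 1 ^+ 2 * (d ^+ 2 + 4 * m * m')
      = 4 * m ^+ 2 * N 0 0 ^+ 2 - 4 * m * N 0 1 * (N 0 0 * d + N 0 1 * m').
    ring.
  have -> : N 0 0 * d + N 0 1 * m' = - (N 1 0 * m) by rewrite E opprK.
  have -> : 4 * m ^+ 2 * N 0 0 ^+ 2 - 4 * m * N 0 1 * - (N 1 0 * m)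
     = 4 * m ^+ 2 * - (N 0 0 * N 1 1 - N 0 1 * N 1 0) by rewrite N11; ring.
  rewrite mulr_ge0_le0 ?oppr_le0 // mulr_ge0 ?sqr_ge0 //.
have N01 : N 0 1 = 0.
  apply/eqP; rewrite -sqrf_eq0; apply/eqP.
  by have := sqr_ge0 (2 * m * N 0 0 - N 0 1 * d); have := sqr_ge0 (N 0 1); nra.
have N00 : N 0 0 = 0.
  move: key; rewrite N01 !mul0r expr0n mul0r !subr0 => key.
  have /eqP : (2 * m * N 0 0) ^+ 2 = 0.
    by apply/eqP; rewrite eq_le key sqr_ge0.
  rewrite sqrf_eq0 !mulf_eq0 pnatr_eq0 /= (negPf M01) => /eqP //.
have N10 : N 1 0 = 0.
  move/eqP: E; rewrite N00 N01 !mul0r addr0 oppr0 mulf_eq0 (negPf M01) orbF.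
  by move/eqP.
by apply/eqP/mx2P; rewrite ?N00 ?N01 ?N10 ?N11 ?N00 ?oppr0 mxE.
Qed.

(** Applied to [M - mu%:M], this factorization turns a real eigenvalue [mu] into a decomposable
    tensor. *)
Lemma singular_mx2 M : \det M = 0 ->
  exists (a : 'cV[R]_2) (u : 'rV[R]_2), M = a *m u.
Proof.
rewrite det2E => detM.
have [z|nz] := eqVneq (row 0 M) 0.
  exists (\col_r (r == 1)%:R), (row 1 M).
  have z0 c : M 0 c = 0 by have /rowP/(_ c) := z; rewrite !mxE.
  by apply: mx2P; rewrite !mxE big_ord1 !mxE /= ?mul0r ?mul1r ?z0.
have /rV0Pn[c] := nz; rewrite mxE => Mc.
exists (\col_r (if r == 0 then 1 else M 1 c / M 0 c)), (row 0 M).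
apply: mx2P; rewrite !mxE big_ord1 !mxE /= ?mul1r //.
all: rewrite mulrAC; apply: (canRL (mulfK Mc)).
all: by elim/forall_ord2: c Mc => _; lra.
Qed.

End PlaneMatrices.

(** * A common step size for finitely many constraints *)

Section FiniteSlack.
Variables (R : realFieldType) (T : finType).

(* Division by 0 being 0, the slack may vanish where the slope does. *)
Lemma common_step (g k : T -> R) : (forall t, 0 <= g t) ->
  (forall t, g t = 0 -> k t = 0) ->
  exists2 e, 0 < e & forall t e', `|e'| <= e -> `|e' * k t| <= g t.
Proof.
move=> g0 gk; pose s := 1 + \sum_t `|k t| / g t.
have s0 t : 0 <= `|k t| / g t by rewrite divr_ge0.
have s1 : 0 < s by rewrite ltr_pwDl // sumr_ge0.
exists s^-1 => [|t e' le_e]; first by rewrite invr_gt0.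
have [z|nz] := eqVneq (g t) 0; first by rewrite gk // mulr0 normr0 z.
have gt0 : 0 < g t by rewrite lt_neqAle eq_sym nz g0.
have le_s : `|k t| <= s * g t.
  rewrite -ler_pdivrMr // /s (bigD1 t) //= addrCA lerDl.
  by rewrite addr_ge0 // sumr_ge0.
rewrite normrM; apply: le_trans (ler_pM _ _ le_e le_s) _ => //.
by rewrite mulKf ?gt_eqF.
Qed.

End FiniteSlack.

(** * Signed areas of triangles under deformation *)

Section Triangles.
Variables (R : realType) (n : nat).
Implicit Types (P Q v w : 'M[R]_(n, 2)) (t : triple n) (a b i j k : 'I_n).

Definition in_triple t a : bool := [|| a == ti t, a == tj t | a == tk t].

Lemma triple_ltn t : (ti t < tj t < tk t)%N.
Proof. exact: (valP t). Qed.

Lemma triple_neq t : [/\ ti t != tj t, ti t != tk t & tj t != tk t].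
Proof.
have /andP[ij jk] := triple_ltn t; rewrite -!(inj_eq val_inj).
by rewrite !neq_ltn ij jk (ltn_trans ij jk).
Qed.

Lemma ti_in t : in_triple t (ti t). Proof. by rewrite /in_triple eqxx. Qed.
Lemma tj_in t : in_triple t (tj t).
Proof. by rewrite /in_triple eqxx orbT. Qed.
Lemma tk_in t : in_triple t (tk t).
Proof. by rewrite /in_triple eqxx !orbT. Qed.

Lemma in_tripleP t (X : 'I_n -> Prop) : X (ti t) -> X (tj t) -> X (tk t) ->
  forall a, in_triple t a -> X a.
Proof. by move=> ? ? ? a /or3P[] /eqP->. Qed.

Definition linear_on t P v (N : 'M[R]_2) : Prop := forall a b,
  in_triple t a -> in_triple t b -> row a v - row b v = (row a P - row b P) *m N.

Definition constant_on t v : Prop := forall a b,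
  in_triple t a -> in_triple t b -> row a v = row b v.

(** The polar form of the quadratic form [Ddet t], that is, its derivative at [P] along [v]. *)
Definition Ddet_polar t P v : R :=
  (P (tj t) 0 - P (ti t) 0) * (v (tk t) 1 - v (ti t) 1)
  + (v (tj t) 0 - v (ti t) 0) * (P (tk t) 1 - P (ti t) 1)
  - (P (tj t) 1 - P (ti t) 1) * (v (tk t) 0 - v (ti t) 0)
  - (v (tj t) 1 - v (ti t) 1) * (P (tk t) 0 - P (ti t) 0).

Lemma Ddet_addZ t P v h : Ddet t (h *: v + P) =
  Ddet t P + h * Ddet_polar t P v + h ^+ 2 * Ddet t v.
Proof. by rewrite !DdetE /Ddet_polar !mxE; ring. Qed.

Lemma diff_sarea P t Q v :
  'd (sarea P t) Q v = 2^-1 * Num.sg (Ddet t P) * Ddet_polar t Q v.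
Proof.
rewrite -deriveE; last exact: differentiable_sarea.
set c := 2^-1 * _; rewrite /derive; apply: cvg_lim; first exact: norm_hausdorff.
have lim0 : (fun h : R => c * Ddet_polar t Q v + h * (c * Ddet t v)) @ 0^'
    --> c * Ddet_polar t Q v.
  rewrite -[X in _ --> X]addr0; apply: cvgD; first exact: cvg_cst.
  rewrite -[X in _ --> X](mul0r (c * Ddet t v)); apply: cvgMl.
  exact: cvg_within.
apply: cvg_trans lim0; apply: near_eq_cvg; near=> h.
have h0 : h != 0 by near: h; exact: nbhs_dnbhs_neq.
rewrite /sarea /= Ddet_addZ -/c /GRing.scale /=.
by apply: (mulfI h0); rewrite mulVKf //; ring.
Unshelve. all: by end_near.
Qed.

(** Adding [h *: v] to [P] multiplies the edges of [t] by [1 + h N], of determinant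
    [1 + h \tr N + h^2 \det N]; these are the coefficients of [h] and [h^2]. *)
Lemma linear_on_det t P v N : linear_on t P v N ->
  Ddet_polar t P v = Ddet t P * \tr N /\ Ddet t v = Ddet t P * \det N.
Proof.
move=> PvN; have lin a (ta : in_triple t a) c : v a c - v (ti t) c =
    (P a 0 - P (ti t) 0) * N 0 c + (P a 1 - P (ti t) 1) * N 1 c.
  by have /rowP/(_ c) := PvN a _ ta (ti_in t); rewrite mul_row2E !mxE.
rewrite !DdetE /Ddet_polar mxtrace2E det2E !(lin _ (tj_in t)) !(lin _ (tk_in t)).
by split; ring.
Qed.

Lemma linear_on_exists t P v : Ddet t P != 0 -> exists N, linear_on t P v N.
Proof.
move=> D0; pose E Q : 'M[R]_2 := \matrix_(r < 2)
  (row (if r == 0 then tj t else tk t) Q - row (ti t) Q).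
have uE : E P \in unitmx.
  rewrite unitmxE unitfE det2E !mxE /=; move: D0; rewrite DdetE.
  by congr (_ != 0).
exists (invmx (E P) *m E v).
have Er r : row r (E v) = row r (E P) *m (invmx (E P) *m E v).
  by rewrite -row_mul mulKVmx.
have Ej := Er 0; have Ek := Er 1; rewrite !rowK /= in Ej Ek.
suff ref a : in_triple t a ->
    row a v - row (ti t) v = (row a P - row (ti t) P) *m (invmx (E P) *m E v).
  move=> a b ta tb.
  transitivity ((row a v - row (ti t) v) - (row b v - row (ti t) v)).
    by rewrite opprB addrA subrK.
  rewrite !ref // -mulmxBl; congr (_ *m _).
  by rewrite opprB addrA subrK.
by move: a; apply: in_tripleP; rewrite ?subrr ?mul0mx.
Qed.

Lemma triple_vertices_inj t P a b : Ddet t P != 0 ->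
  in_triple t a -> in_triple t b -> row a P = row b P -> a = b.
Proof.
move=> D0 ta tb E; apply/eqP; apply: contraNT D0 => ab.
have Ec c : P a c = P b c by have /rowP/(_ c) := E; rewrite !mxE.
rewrite DdetE; move: a ta b tb ab E Ec.
do 2! [apply: in_tripleP]; rewrite ?eqxx // => _ _ Ec; rewrite !Ec;
  apply/eqP; ring.
Qed.

Lemma constant_on_mem t v x : constant_on t v ->
  (forall a, in_triple t a -> row a v = x) \/
  (forall a, in_triple t a -> row a v != x).
Proof.
move=> cst; have [<-|ne] := eqVneq (row (ti t) v) x.
  by left=> a ta; apply: cst (ti_in t).
by right=> a ta; rewrite (cst a (ti t)) // ti_in.
Qed.

(* The two other vertices [b], [c] come in the cyclic order of the triangle. *)
Lemma Ddet_replace t i : in_triple t i -> exists b c,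
  [/\ [/\ in_triple t b, in_triple t c & b != c], i != b, i != c
   & forall P z, Ddet t (replace_pt P i (row i P + z)) =
      Ddet t P + z 0 0 * (P b 1 - P c 1) - z 0 1 * (P b 0 - P c 0)].
Proof.
have [ij ik jk] := triple_neq t.
have [ji ki kj] : [/\ tj t != ti t, tk t != ti t & tk t != tj t].
  by rewrite ![tk t == _]eq_sym [tj t == _]eq_sym.
case/or3P => /eqP->.
- exists (tj t), (tk t); split=> [|//|//|]; first by rewrite tj_in tk_in.
  move=> P z; rewrite !DdetE !mxE eqxx (negPf ji) (negPf ki); ring.
- exists (tk t), (ti t); split=> [|//|//|]; first by rewrite ti_in tk_in.
  move=> P z; rewrite !DdetE !mxE eqxx (negPf ij) (negPf kj); ring.
- exists (ti t), (tj t); split=> [|//|//|]; first by rewrite ti_in tj_in.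
  move=> P z; rewrite !DdetE !mxE eqxx (negPf ik) (negPf jk); ring.
Qed.

Lemma Ddet_replace_notin t i P p : ~~ in_triple t i ->
  Ddet t (replace_pt P i p) = Ddet t P.
Proof.
rewrite /in_triple !negb_or ![i == _]eq_sym => /and3P[/negPf i1 /negPf i2 /negPf i3].
by rewrite !DdetE !mxE i1 i2 i3.
Qed.

Lemma sarea_replace_affine t i P z e :
  sarea P t (replace_pt P i (row i P + e *: z)) =
  sarea P t P + e * (sarea P t (replace_pt P i (row i P + z)) - sarea P t P).
Proof.
rewrite /sarea; have [it|it] := boolP (in_triple t i).
  by have [b [c [_ _ _ H]]] := Ddet_replace it; rewrite !H !mxE; ring.
by rewrite !(Ddet_replace_notin _ _ it); ring.
Qed.

Lemma sarea_area P t : sarea P t P = area t P.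
Proof. by rewrite /sarea /area -mulrA normrEsg. Qed.

End Triangles.

(** * Maximizers, pinned points and multipliers *)

Section Maximizers.
Variables (R : realType) (n : nat).
Implicit Types (P Q v w : 'M[R]_(n, 2)) (t : triple n) (a b i j k : 'I_n).
Local Notation Delta := (Delta R n).

Lemma area_ge0 P t : 0 <= area t P.
Proof. by rewrite /area mulr_ge0. Qed.

Lemma some_triple : (3 <= n)%N -> triple n.
Proof.
move=> n3; have [n1 n2] : (0 < n)%N /\ (1 < n)%N by lia.
by exists (Ordinal n1, Ordinal n2, Ordinal n3).
Qed.

Lemma delta_le_area P t : delta P <= area t P.
Proof.
apply: ge_inf; last by exists t.
by exists 0 => _ [t' _ <-]; exact: area_ge0.
Qed.

Lemma area_le1 P t : in_cube P -> area t P <= 1.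
Proof.
move=> cP; have bnd a c : 0 <= P a c <= 1 by have := cP a c; rewrite mxE.
rewrite /area mulrC ler_pdivrMr // mul1r DdetE ler_norml.
have [[? ?] [? ?]] := (andP (bnd (ti t) 0), andP (bnd (ti t) 1)).
have [[? ?] [? ?]] := (andP (bnd (tj t) 0), andP (bnd (tj t) 1)).
have [[? ?] [? ?]] := (andP (bnd (tk t) 0), andP (bnd (tk t) 1)).
by apply/andP; split; nra.
Qed.

(** For points of the parabola [y = x^2] with abscissas [i / n], the determinants are Vandermonde
    products of three gaps, each at least [1 / n]. *)
Lemma Delta_gt0 : (3 <= n)%N -> 0 < Delta.
Proof.
move=> n3; have t0 := some_triple n3.
have n0 : 0 < n%:R :> R by rewrite ltr0n; lia.
pose x (i : 'I_n) : R := i%:R / n%:R.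
pose Q : 'M[R]_(n, 2) := \matrix_(i, c) (if c == 0 then x i else x i ^+ 2).
have x01 i : 0 <= x i <= 1.
  by rewrite divr_ge0 //= ler_pdivrMr // mul1r ler_nat ltnW.
have cQ : in_cube Q.
  move=> i; rewrite /in_square => c; rewrite !mxE; have /andP[x0 x1] := x01 i.
  by case: ifP => _; rewrite ?x0 ?x1 // exprn_ge0 //= exprn_ile1.
have gap i j : (i < j)%N -> n%:R^-1 <= x j - x i.
  move=> ij; rewrite /x -mulrBl ler_peMl ?invr_ge0 ?(ltW n0) //.
  by rewrite lerBrDl natr1 ler_nat.
apply: lt_le_trans (_ : 2^-1 * n%:R^-1 ^+ 3 <= _).
  by rewrite mulr_gt0 // exprn_gt0 // invr_gt0.
apply: le_trans (_ : delta Q <= _); last first.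
  apply: ub_le_sup; last by exists Q.
  exists 1 => _ [Q' cQ' <-].
  exact: le_trans (delta_le_area Q' t0) (area_le1 t0 cQ').
apply: lb_le_inf; first by exists (area t0 Q), t0.
move=> _ [t _ <-]; rewrite /area ler_pM2l ?invr_gt0 //.
have /andP[ij jk] := triple_ltn t; have ik := ltn_trans ij jk.
have -> : Ddet t Q = (x (tj t) - x (ti t)) * (x (tk t) - x (ti t))
    * (x (tk t) - x (tj t)) by rewrite DdetE !mxE /=; ring.
have v0 : 0 <= n%:R^-1 :> R by rewrite invr_ge0 ltW.
apply: le_trans (ler_norm _); rewrite exprSr expr2.
by rewrite !ler_pM ?mulr_ge0 ?gap.
Qed.

Lemma tight_Ddet P t : 0 < Delta -> tight P t -> Ddet t P != 0.
Proof.
move=> D0 /eqP E; apply: contraTneq D0 => Dt.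
by rewrite -E /area Dt normr0 mulr0 ltxx.
Qed.

(** Small steps along [z] and [- z], the height changing at rate [s], stay in the polyhedron, and a
    vertex is not the midpoint of a proper segment. *)
Lemma pinned_direction P i (z : 'rV[R]_2) s : maximizers P ->
  vertex (one_point_polyhedron P i) (row i P, Delta) ->
  (forall c, on_side (P i c) -> z 0 c = 0) ->
  (forall t, tight P t ->
     sarea P t (replace_pt P i (row i P + z)) = sarea P t P + s) ->
  z = 0.
Proof.
move=> [cP dP] [_ ext] z_side z_tight.
(* The rate of [t] relative to [s]; it vanishes on tight triangles, the only ones without slack. *)
pose k t := sarea P t (replace_pt P i (row i P + z)) - sarea P t P - s.
have gt0 t : 0 <= area t P - Delta by rewrite subr_ge0 -dP delta_le_area.
have gk t : area t P - Delta = 0 -> k t = 0.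
  by move/eqP; rewrite subr_eq0 => tt; rewrite /k z_tight //; ring.
have [e1 e1_gt0 step1] := common_step gt0 gk.
have Pic c : 0 <= P i c <= 1 by have := cP i c; rewrite mxE.
have m0 c : 0 <= Num.min (P i c) (1 - P i c).
  by have /andP[? ?] := Pic c; rewrite le_min subr_ge0; apply/andP.
have mz c : Num.min (P i c) (1 - P i c) = 0 -> z 0 c = 0.
  move=> E; apply: z_side; move: E; rewrite /on_side; case: leP => _.
    by move=> ->; rewrite eqxx.
  by move/eqP; rewrite subr_eq0 eq_sym => ->; rewrite orbT.
have [e2 e2_gt0 step2] := common_step m0 mz.
pose e := Num.min e1 e2.
have e_gt0 : 0 < e by rewrite lt_min e1_gt0.
have mem e' : `|e'| <= e ->
    one_point_polyhedron P i (row i P + e' *: z, Delta + e' * s).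
  rewrite le_min => /andP[le1 le2]; split=> /= [c|t].
    have := step2 c e' le2; rewrite le_min !mxE !ler_norml.
    by move=> /andP[/andP[? ?] /andP[? ?]]; apply/andP; split; lra.
  rewrite sarea_replace_affine sarea_area.
  by have := step1 t e' le1; rewrite /k sarea_area ler_norml => /andP[? ?]; lra.
have [/(congr1 fst) /= E _] : (row i P + e *: z, Delta + e * s) = (row i P, Delta)
    /\ (row i P + (- e) *: z, Delta + (- e) * s) = (row i P, Delta).
  apply: (ext _ _ 2^-1); [by apply: mem; rewrite ger0_norm ?(ltW e_gt0) | | |].
  - by apply: mem; rewrite normrN ger0_norm ?(ltW e_gt0).
  - by apply/andP; split; lra.
  apply: injective_projections => /=; last by rewrite /GRing.scale /=; field.
  by apply/rowP => c; rewrite !mxE /=; field.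
move: E; rewrite -[X in _ = X]addr0 => /addrI/eqP.
by rewrite scaler_eq0 gt_eqF //= => /eqP.
Qed.

Lemma Bt_mul P t (x : 'cV[R]_n) : Bt P t *m x = Num.sg (Ddet t P) *:
  ((x (tk t) 0 - x (ti t) 0) *: (evec R (tj t) - evec R (ti t))
   - (x (tj t) 0 - x (ti t) 0) *: (evec R (tk t) - evec R (ti t))).
Proof.
have E a b : (evec R a - evec R b)^T *m x = (x a 0 - x b 0)%:M.
  rewrite linearB /= /evec !trmx_delta mulmxBl -!rowE.
  by rewrite [LHS]mx11_scalar !mxE.
by rewrite /Bt -scalemxAl mulmxBl -!mulmxA !E !mul_mx_scalar.
Qed.

Lemma mem_Ksh P (x : 'cV[R]_n) :
  x \in Ksh P <-> forall q, KKT P q -> Bq P q *m x = 0.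
Proof.
split=> [/mem_bigcapv xK q /xK|xK].
  by rewrite memv_ker lfunE => /eqP.
by apply/mem_bigcapv => q /xK; rewrite memv_ker lfunE => /eqP.
Qed.

Lemma Bq_mul P q (x : 'cV[R]_n) :
  Bq P q *m x = \sum_t mlam q t *: (Bt P t *m x).
Proof. by rewrite mulmx_suml; under eq_bigr do rewrite -scalemxAl. Qed.

Lemma ones_Ksh P : ones R n \in Ksh P.
Proof.
apply/mem_Ksh => q _; rewrite Bq_mul big1 // => t _.
by rewrite Bt_mul !mxE subrr !scale0r subrr !scaler0.
Qed.

(** Column [i] of each [Bq P q] vanishes. Uncharged points thus contribute to the dimension of the
    shared kernel, which bounds their number. *)
Lemma evec_Ksh P i : (forall q, KKT P q -> forall t, mlam q t != 0 ->
    ~~ in_triple t i) -> evec R i \in Ksh P.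
Proof.
move=> free; apply/mem_Ksh => q Kq; rewrite Bq_mul big1 // => t _.
have [->|/(free q Kq)] := eqVneq (mlam q t) 0; first by rewrite scale0r.
rewrite /in_triple ![i == _]eq_sym !negb_or => /and3P[/negPf i1 /negPf i2 /negPf i3].
by rewrite Bt_mul !mxE i1 i2 i3 subrr !scale0r subrr !scaler0.
Qed.

(** The sum is the bilinear form of [Bq P q] evaluated at the two columns of [v], and [Bq P q] kills
    the second one. *)
Lemma second_order_zero P q v : KKT P q ->
  (forall c, col c v \in Ksh P) ->
  \sum_t mlam q t * (Num.sg (Ddet t P) * Ddet t v) = 0.
Proof.
move=> Kq vK; transitivity (((col 0 v)^T *m (Bq P q *m col 1 v)) 0 0); last first.
  by have /mem_Ksh-> := vK 1; rewrite ?mulmx0 ?mxE.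
have E (y : 'cV[R]_n) a b : (y^T *m (evec R a - evec R b)) 0 0 = y a 0 - y b 0.
  by rewrite mulmxBr /evec -!colE !mxE.
have lin (A B : 'M[R]_1) (l s x z : R) :
    (l *: (s *: (x *: A - z *: B))) 0 0 = l * (s * (x * A 0 0 - z * B 0 0)).
  by rewrite !mxE.
rewrite Bq_mul mulmx_sumr summxE; apply: eq_bigr => t _.
rewrite Bt_mul -!scalemxAr mulmxBr -!scalemxAr lin !E (DdetE t v) !mxE; ring.
Qed.

(* Euler's identity: [Ddet t] is linear in the vector of [c]-coordinates, and on
   a union of components of the multiplier touching no side of direction [c]
   stationarity kills the derivative along that vector. *)
Lemma sideless_component P q c (S : pred 'I_n) : KKT P q ->
  (forall t, mlam q t != 0 ->
     (forall a, in_triple t a -> S a) \/ (forall a, in_triple t a -> ~~ S a)) ->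
  (forall i, S i -> ~~ on_side (P i c)) ->
  forall t, (forall a, in_triple t a -> S a) -> mlam q t * area t P = 0.
Proof.
move=> Kq sat side; pose V := \sum_(i | S i) P i c *: delta_mx i c : 'M[R]_(n, 2).
have VE a c' : V a c' = if S a && (c' == c) then P a c else 0.
  rewrite /V summxE; case Sa: (S a) => /=.
    rewrite (bigD1 a) //= big1 ?addr0 => [|i /andP[_ ia]]; rewrite !mxE.
      by rewrite eqxx; case: eqP => _; rewrite ?mulr1 ?mulr0.
    by rewrite eq_sym (negPf ia) mulr0.
  rewrite big1 // => i Si; rewrite !mxE.
  by case: eqP Si => [<-|_ _]; rewrite ?Sa ?mulr0.
have dE t : mlam q t != 0 -> 'd (sarea P t) P V =
    if S (ti t) then area t P else 0.
  move=> /sat St; rewrite diff_sarea -sarea_area /sarea /Ddet_polar DdetE !VE.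
  have [/= Si|/= Si] := boolP (S (ti t)); last first.
    have nS a (ta : in_triple t a) : S a = false.
      case: St => H; first by rewrite H ?ti_in in Si.
      exact/negbTE/H.
    by rewrite !nS ?tj_in ?tk_in //=; ring.
  have yS a (ta : in_triple t a) : S a.
    by case: St => H; [exact: H|have := H _ (ti_in t); rewrite Si].
  rewrite !yS ?tj_in ?tk_in //; clear; move: c.
  by apply: forall_ord2 => /=; ring.
have tot : \sum_t mlam q t * (if S (ti t) then area t P else 0) = 0.
  transitivity (\sum_t mlam q t * 'd (sarea P t) P V).
    apply: eq_bigr => t _.
    by have [->|/dE->//] := eqVneq (mlam q t) 0; rewrite !mul0r.
  transitivity (\sum_(i | S i) P i c * \sum_t mlam q t * gradA P t i 0 c).
    under [RHS]eq_bigr do rewrite big_distrr /=.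
    rewrite exchange_big; apply: eq_bigr => t _; rewrite /V linear_sum big_distrr.
    apply: eq_bigr => i _; rewrite linearZ /= /gradA mxE deriveE.
      by rewrite /GRing.scale /=; ring.
    exact: differentiable_sarea.
  (* Off both sides of direction [c] the boundary multipliers are 0, so the weighted gradient alone
     vanishes in that direction. *)
  apply: big1 => i Si.
  have /rowP/(_ c) := kkt_stationary Kq i; rewrite !mxE summxE.
  under eq_bigr do rewrite mxE.
  have := side i Si; rewrite /on_side negb_or.
  move: c {side V VE dE}; apply: forall_ord2 => /andP[i0 i1] /=.
    by rewrite (kkt_left Kq) // (kkt_right Kq) // subrr addr0 => ->; rewrite mulr0.
  by rewrite (kkt_down Kq) // (kkt_up Kq) // subrr addr0 => ->; rewrite mulr0.
(* The goal is recast as a summand of [tot], whose summands are all nonnegative. *)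
move=> t St; rewrite -[area t P]/(if true then _ else 0) -(St _ (ti_in t)).
move: t {St} (isT); apply: psumr_eq0P tot => t _.
by case: ifP => _; rewrite ?mulr0 // mulr_ge0 ?area_ge0 ?(kkt_lam_ge0 Kq).
Qed.

End Maximizers.

(** * From the plane [W P] to an elliptic pair *)

Section Pencil.
Variables (R : realType) (n : nat).
Implicit Types (P Q v w : 'M[R]_(n, 2)) (t : triple n) (a b i j k : 'I_n).
Implicit Type M N : 'M[R]_2.
Local Notation Delta := (Delta R n).

Lemma rV2_vec2 (u : 'rV[R]_2) : u = u 0 0 *: vec2 1 0 + u 0 1 *: vec2 0 1.
Proof.
by apply/rowP; apply: forall_ord2; rewrite !mxE /= ?mulr1 ?mulr0 ?addr0 ?add0r.
Qed.

Lemma mem_Ttr i0 v : v \in Ttr R n <-> forall a b, row a v = row b v.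
Proof.
split=> [|cst].
  rewrite /Ttr span_cons span_seq1.
  move=> /memv_addP[_ /vlineP[x ->] [_ /vlineP[y ->] ->]] a b.
  by apply/rowP => c; rewrite !mxE !big_ord1 !mxE.
have -> : v = velocity (ones R n) (row i0 v).
  apply/matrixP => a c; rewrite !mxE big_ord1 !mxE mul1r.
  by have /rowP/(_ c) := cst a i0; rewrite !mxE.
rewrite (rV2_vec2 (row i0 v)) /velocity mulmxDr -!scalemxAr.
by rewrite rpredD // rpredZ // memv_span // !inE eqxx ?orbT.
Qed.

Definition tight_kernel P : {vspace 'M[R]_(n, 2)} :=
  (Ksh2 P :&: lker (Jtight P))%VS.

Lemma mem_tight_kernel P v : v \in tight_kernel P ->
  [/\ forall c, col c v \in Ksh P,
      forall t, tight P t -> 'd (sarea P t) P v = 0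
    & forall c i j, on_side (P i c) -> on_side (P j c) -> v i c = v j c].
Proof.
rewrite memv_cap => /andP[vK]; rewrite memv_ker lfunE /= => /eqP[J1 J2 J3].
split=> [c|t tt|].
- move: vK; rewrite memvE => /subv_bigcapP/(_ c isT).
  by rewrite -memvE -memv_preim lfunE.
- by have /ffunP/(_ (exist _ t tt)) := J1; rewrite !ffunE.
apply: forall_ord2 => i j si sj; have sij := introT andP (conj si sj).
  by have /ffunP/(_ (exist _ (i, j) sij)) := J2; rewrite !ffunE => /subr0_eq.
by have /ffunP/(_ (exist _ (i, j) sij)) := J3; rewrite !ffunE => /subr0_eq.
Qed.

Lemma dim_Ksh P (i0 : 'I_n) : \dim (Ksh P) = (\dim (H0 P)).+1.
Proof.
rewrite -(limg_ker_dim (vclass <[ones R n]>%VS) (Ksh P)) lker_vclass.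
have /capv_idPr-> : (<[ones R n]> <= Ksh P)%VS by rewrite -memvE ones_Ksh.
rewrite dim_vline -[LHS]/(_ + \dim (H0 P))%N.
suff -> : ones R n != 0 by [].
by apply/eqP => /colP/(_ i0)/eqP; rewrite !mxE oner_eq0.
Qed.

Lemma free2_eq0 (V : vectType R) (x y : V) (l m : R) : free [:: x; y] ->
  l *: x + m *: y = 0 -> l = 0 /\ m = 0.
Proof.
rewrite free_cons span_seq1 seq1_free => /andP[xy y0] E.
have l0 : l = 0.
  apply: contraNeq xy => l0; apply/vlineP; exists (- (m / l)).
  apply: (scalerI l0); rewrite scalerA mulrN mulrCA divff // mulr1 scaleNr.
  by apply/eqP; rewrite -addr_eq0 E.
split=> //; move/eqP: E; rewrite l0 scale0r add0r scaler_eq0 (negPf y0) orbF.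
by move/eqP.
Qed.

(** The two traces encode the first variations along [v] and [v *m M]. In [ell_side] whole rows
    agree, not only their coordinate [c]. *)
Record elliptic P v M : Prop := Elliptic {
  ell_Ksh : forall c, col c v \in Ksh P;
  ell_tight : forall t, tight P t ->
    exists N, [/\ linear_on t P v N, \tr N = 0 & \tr (N *m M) = 0];
  ell_side : forall c i j, on_side (P i c) -> on_side (P j c) ->
    row i v = row j v;
  ell_disc : (\tr M) ^+ 2 < 4 * \det M;
  ell_nonconstant : exists a b, row a v != row b v }.

Section Existence.
Variables (P : 'M[R]_(n, 2)) (i0 : 'I_n) (Delta0 : 0 < Delta).
Hypotheses (dimH0 : \dim (H0 P) = 2%N) (dimW : \dim (W P) = 2%N).
Hypothesis nodec : forall (h : vquot <[ones R n]>%VS) (u : 'rV[R]_2),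
  h \in H0 P -> tensor h u \in W P -> tensor h u = 0.

(** Up to translation [v] is [velocity k u], so its class is a decomposable tensor in [W P] and
    [nodec] applies. *)
Lemma tensor_tight_kernel v (k : 'cV[R]_n) u : v \in tight_kernel P ->
  k \in Ksh P ->
  (forall a b, row a v - row b v = (k a 0 - k b 0) *: u) -> v \in Ttr R n.
Proof.
move=> vV kK E.
have Ec : vclass (Ttr R n) v = tensor (vclass <[ones R n]>%VS k) u.
  rewrite tensorE; apply/eqP; rewrite vclass_eq; apply/(mem_Ttr i0) => a b.
  apply/rowP => c; rewrite !mxE !big_ord1.
  by have /rowP/(_ c) := E a b; rewrite !mxE => Eab; lra.
rewrite -(lker_vclass (Ttr R n)) memv_ker Ec; apply/eqP/nodec; first exact: memv_img.
by rewrite -Ec; exact: memv_img.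
Qed.

Lemma tight_kernel_pair : exists v1 v2, [/\ v1 \in tight_kernel P,
  v2 \in tight_kernel P &
  forall l m, l *: v1 + m *: v2 \in Ttr R n -> l = 0 /\ m = 0].
Proof.
have := basis_free (vbasisP (W P)).
have : {subset tval (vbasis (W P)) <= W P} by move=> x; exact: vbasis_mem.
have := etrans (size_tuple (vbasis (W P))) dimW.
case: (tval (vbasis (W P))) => [|x [|y []]] //= _ mem fr.
have /memv_imgP[v1 V1 E1] := mem x (mem_head _ _).
have /memv_imgP[v2 V2 E2] : y \in W P by apply: mem; rewrite !inE eqxx orbT.
exists v1, v2; split=> // l m.
rewrite -(lker_vclass (Ttr R n)) memv_ker linearD !linearZ /=.
by rewrite -E1 -E2 => /eqP/(free2_eq0 fr).
Qed.

(** The columns of [v] and [ones] form a basis of the three-dimensional shared kernel: a linear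
    relation between them would make [v] decomposable. *)
Lemma Ksh_coordinates v (k : 'cV[R]_n) : v \in tight_kernel P ->
  v \notin Ttr R n -> k \in Ksh P -> exists m : 'cV[R]_2, forall a b,
  k a 0 - k b 0 = ((row a v - row b v) *m m) 0 0.
Proof.
move=> vV vT kK; have [vK _ _] := mem_tight_kernel vV.
have spanE (x : 'cV[R]_n) : x \in <<[:: col 1 v; ones R n]>>%VS ->
    exists l m, forall a, x a 0 = l * v a 1 + m.
  rewrite span_cons span_seq1 => /memv_addP[_ /vlineP[l ->] [_ /vlineP[m ->] ->]].
  by exists l, m => a; rewrite !mxE mulr1.
pose X := [:: col 0 v; col 1 v; ones R n].
have frX : free X.
  rewrite /X 2!free_cons span_seq1 seq1_free; apply/and3P; split.
  - apply: contra vT => /spanE[l [m E]].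
    apply: (tensor_tight_kernel vV (vK 1) (u := vec2 l 1)) => a b.
    apply/rowP; apply: forall_ord2; rewrite !mxE /=; last by rewrite mulr1.
    by have := E a; have := E b; rewrite !mxE => -> ->; ring.
  - apply: contra vT => /vlineP[l /colP E].
    apply: (tensor_tight_kernel vV (vK 0) (u := vec2 1 0)) => a b.
    apply/rowP; apply: forall_ord2; rewrite !mxE /=; first by rewrite mulr1.
    by have := E a; have := E b; rewrite !mxE => -> ->; ring.
  - by apply/eqP => /colP/(_ i0)/eqP; rewrite !mxE oner_eq0.
have KshE : Ksh P = <<X>>%VS.
  apply/esym/eqP; rewrite eqEdim (eqP frX) (dim_Ksh P i0) dimH0 leqnn andbT.
  apply/span_subvP => x; rewrite !inE => /or3P[] /eqP->; rewrite ?vK //.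
  exact: ones_Ksh.
move: kK; rewrite KshE span_cons.
move=> /memv_addP[_ /vlineP[l0 ->] [x /spanE[l1 [m xE]] ->]].
exists (\col_r (if r == 0 then l0 else l1)) => a b.
by rewrite !mxE sum_ord2 !mxE !xE /=; ring.
Qed.

(** [M] holds the coordinates of the columns of [v2] in those of [v1], modulo constants. *)
Lemma elliptic_exists : exists v M, elliptic P v M.
Proof.
have [v1 [v2 [V1 V2 ind]]] := tight_kernel_pair.
have v1T : v1 \notin Ttr R n.
  apply/negP => v1T; have [] := ind 1 0; last by move/eqP; rewrite oner_eq0.
  by rewrite scale1r scale0r addr0.
have [v1K J1 side1] := mem_tight_kernel V1.
have [v2K J2 side2] := mem_tight_kernel V2.
have [m0 E0] := Ksh_coordinates V1 v1T (v2K 0).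
have [m1 E1] := Ksh_coordinates V1 v1T (v2K 1).
pose M : 'M[R]_2 := \matrix_(r, c) (if c == 0 then m0 r 0 else m1 r 0).
have EM a b : row a v2 - row b v2 = (row a v1 - row b v1) *m M.
  apply/rowP; apply: forall_ord2.
    by have := E0 a b; rewrite !mxE !sum_ord2 !mxE.
  by have := E1 a b; rewrite !mxE !sum_ord2 !mxE.
(* Otherwise [M] has a real eigenvalue [mu] and [v2 - mu *: v1] is decomposable, hence a
   translation, against [ind]. *)
have disc : (\tr M) ^+ 2 < 4 * \det M.
  rewrite ltNge; apply/negP => le_disc.
  pose s := Num.sqrt ((\tr M) ^+ 2 - 4 * \det M).
  have s2 : s ^+ 2 = (\tr M) ^+ 2 - 4 * \det M by rewrite sqr_sqrtr // subr_ge0.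
  pose mu := (\tr M + s) / 2.
  have [|x [u Mxu]] := @singular_mx2 _ (M - mu%:M).
    have E (A : 'M[R]_2) (r c : 'I_2) : (A - mu%:M) r c = A r c - mu *+ (r == c).
      by rewrite !mxE.
    by move: s2; rewrite !det2E !E /mu mxtrace2E => s2 /=; lra.
  have [] := ind (- mu) 1; last by move=> _ /eqP; rewrite oner_eq0.
  apply: (@tensor_tight_kernel _ (v1 *m x) u).
  - by rewrite memvD ?memvZ.
  - have -> : v1 *m x = x 0 0 *: col 0 v1 + x 1 0 *: col 1 v1.
      by apply/colP => a; rewrite !mxE sum_ord2 mulrC [v1 a 1 * _]mulrC.
    by rewrite memvD ?memvZ.
  move=> a b; transitivity ((row a v1 - row b v1) *m (M - mu%:M)).
    rewrite mulmxBr -EM mul_mx_scalar; apply/rowP => c; rewrite !mxE; ring.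
  rewrite Mxu mulmxA [_ *m x]mx11_scalar mul_scalar_mx; congr (_ *: _).
  by rewrite mulmxBl -!row_mul !mxE.
exists v1, M; split=> //.
- move=> t tt; have Dt := tight_Ddet Delta0 tt.
  have [N lin] := linear_on_exists v1 Dt; exists N.
  have lin2 : linear_on t P v2 (N *m M).
    by move=> a b ta tb; rewrite EM lin // mulmxA.
  have polar0 w : 'd (sarea P t) P w = 0 -> Ddet_polar t P w = 0.
    move/eqP; rewrite diff_sarea !mulf_eq0 invr_eq0 pnatr_eq0 sgr_eq0 (negPf Dt).
    by move/eqP.
  have tr0 w N' : linear_on t P w N' -> 'd (sarea P t) P w = 0 -> \tr N' = 0.
    move=> /linear_on_det[E _] /polar0/eqP.
    by rewrite E mulf_eq0 (negPf Dt) => /eqP.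
  by split=> //; [exact: tr0 lin (J1 t tt)|exact: tr0 lin2 (J2 t tt)].
(* Coordinate [c] vanishes in both [d] and [d *m M]; the nonzero off-diagonal entry of [M] then
   kills the other coordinate of [d]. *)
- move=> c i j si sj; have [M01 M10] := elliptic_offdiag disc.
  have := EM i j; move: (side1 c i j si sj) (side2 c i j si sj).
  set d := row i v1 - row j v1 => s1 s2 /rowP/(_ c).
  have dc : d 0 c = 0 by rewrite !mxE s1 subrr.
  rewrite [LHS]mxE mxE [X in _ + X]mxE mxE s2 subrr mul_row2E => /esym/eqP.
  move=> dM; apply: subr0_eq; rewrite -/d; apply/rowP; move: c dc dM {si sj s1 s2}.
  apply: forall_ord2 => dc; rewrite dc mul0r ?add0r ?addr0 mulf_eq0.
    by rewrite (negPf M10) orbF => /eqP dc'; apply: forall_ord2; rewrite ?dc ?dc' mxE.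
  by rewrite (negPf M01) orbF => /eqP dc'; apply: forall_ord2; rewrite ?dc ?dc' mxE.
apply: contrapT => cst; move/negP: v1T; apply; apply/(mem_Ttr i0) => a b.
by apply: contrapT => ab; apply: cst; exists a, b; apply/eqP.
Qed.

End Existence.
End Pencil.

(** * Level sets of an elliptic velocity *)

Section EllipticPencil.
Variables (R : realType) (n : nat) (P v : 'M[R]_(n, 2)) (M : 'M[R]_2).
Implicit Types (t : triple n) (a b i j k : 'I_n) (N : 'M[R]_2).
Hypotheses (Delta0 : 0 < Delta R n) (ell : elliptic P v M).

(** A nonzero [N] has negative determinant, hence is injective and separates the distinct vertices
    of [t]. *)
Lemma linear_on_constant t N a b : tight P t -> linear_on t P v N ->
  \tr N = 0 -> \tr (N *m M) = 0 -> in_triple t a -> in_triple t b -> a != b ->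
  row a v = row b v -> constant_on t v.
Proof.
move=> tt lin trN trNM ta tb ab E; have Dt := tight_Ddet Delta0 tt.
have [N0|N0] := eqVneq N 0.
  by move=> i j ti tj; apply: subr0_eq; rewrite lin // N0 mulmx0.
have uN : N \in unitmx.
  by rewrite unitmxE unitfE lt_eqF // (det_trace_orth (ell_disc ell)).
suff ab' : a = b by rewrite ab' eqxx in ab.
apply: (triple_vertices_inj Dt ta tb); apply: subr0_eq.
by rewrite -[LHS](mulmxK uN) -lin // E subrr mul0mx.
Qed.

Lemma support_constant q t : KKT P q -> mlam q t != 0 -> constant_on t v.
Proof.
move=> Kq lt.
have tightP t' : mlam q t' != 0 -> tight P t'.
  by apply: contraNT => /(kkt_lam_tight Kq)->.
(* The term is [\det N] times the positive number [|Ddet t' P|]; the equality case is what later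
   gives [N = 0]. *)
have neg t' : mlam q t' != 0 -> exists2 N, linear_on t' P v N &
    Num.sg (Ddet t' P) * Ddet t' v <= 0 ?= iff (N == 0).
  move=> /tightP tt; have [N [lin trN trNM]] := ell_tight ell tt.
  exists N => //; have [_ ->] := linear_on_det lin; rewrite mulrA -normrEsg.
  have Dt : 0 < `|Ddet t' P| by rewrite normr_gt0 (tight_Ddet Delta0 tt).
  have [->|N0] := eqVneq N 0; first by rewrite det0 mulr0; apply/leifP.
  by apply/leifP; rewrite pmulr_rlt0 // (det_trace_orth (ell_disc ell)).
have [N lin [_ N0]] := neg t lt.
suff /eqP : Num.sg (Ddet t P) * Ddet t v = 0.
  rewrite N0 => /eqP NE a b ta tb; apply: subr0_eq.
  by rewrite lin // NE mulmx0.
have le0 t' : 0 <= - (mlam q t' * (Num.sg (Ddet t' P) * Ddet t' v)).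
  rewrite oppr_ge0; have [->|/[dup] lt' /neg[? _ [le _]]] := eqVneq (mlam q t') 0.
    by rewrite mul0r.
  by rewrite mulr_ge0_le0 // (kkt_lam_ge0 Kq).
have /eqP := second_order_zero Kq (ell_Ksh ell).
rewrite -oppr_eq0 -sumrN => /eqP /(psumr_eq0P (fun t' _ => le0 t'))/(_ t isT).
by move/eqP; rewrite oppr_eq0 mulf_eq0 (negPf lt) => /eqP.
Qed.

(** The level set of [v] through [t] contains or avoids each charged triangle; if it met no side of
    direction [c], Euler's identity would give [t] weight 0. *)
Lemma support_side q t c : KKT P q -> mlam q t != 0 ->
  exists2 i, on_side (P i c) & row i v = row (ti t) v.
Proof.
move=> Kq lt; have cst := support_constant Kq lt.
pose S i := row i v == row (ti t) v.
have tt : tight P t by apply: contraNT lt => /(kkt_lam_tight Kq)->.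
apply: contrapT => none; move: lt; apply/negP; rewrite negbK.
have sat t' : mlam q t' != 0 ->
    (forall a, in_triple t' a -> S a) \/ (forall a, in_triple t' a -> ~~ S a).
  move=> /(support_constant Kq) /(constant_on_mem (row (ti t) v))[] H.
    by left=> a /H E; apply/eqP.
  by right=> a /H.
have side i : S i -> ~~ on_side (P i c).
  by move=> /eqP Si; apply/negP => si; apply: none; exists i.
have St a : in_triple t a -> S a.
  by move=> ta; apply/eqP; apply: cst (ti_in t).
have /eqP := sideless_component Kq sat side St.
by rewrite (eqP tt) mulf_eq0 (gt_eqF Delta0) orbF.
Qed.

Hypothesis K_neq0 : exists q, KKT P q.

(** The level of one charged triangle meets sides of both directions, so by [ell_side] it contains
    all side points; every other charged level also meets a side. *)
Lemma support_level : exists x, [/\ exists i, row i v = x,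
  forall c i, on_side (P i c) -> row i v = x &
  forall q t a, KKT P q -> mlam q t != 0 -> in_triple t a -> row a v = x].
Proof.
have [q0 Kq0] := K_neq0.
have [t0 lt0] : exists t, mlam q0 t != 0.
  apply: contrapT => none; have /eqP := kkt_sum Kq0.
  rewrite big1 => [|t _]; first by rewrite eq_sym oner_eq0.
  by apply/eqP; apply: contrapT => /negP lt; apply: none; exists t.
have sides c i : on_side (P i c) -> row i v = row (ti t0) v.
  have [j sj <-] := support_side c Kq0 lt0.
  by move=> si; exact: (ell_side ell si sj).
exists (row (ti t0) v); split=> //; first by exists (ti t0).
move=> q t a Kq lt ta; have [i si E] := support_side 0 Kq lt.
by rewrite -(sides _ _ si) E; apply: (support_constant Kq lt) (ti_in t).
Qed.

Variable x : 'rV[R]_2.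
Hypothesis (x_side : forall c i, on_side (P i c) -> row i v = x).
Hypothesis (x_support : forall q t a,
  KKT P q -> mlam q t != 0 -> in_triple t a -> row a v = x).
Hypotheses (x_level : exists i, row i v = x) (dimK : \dim (Ksh P) = 3%N).

(* The unit vectors outside the level set of [x] and the vector of ones are
   independent elements of the shared kernel. *)
Lemma at_most_two_outside i j k : row i v != x -> row j v != x ->
  row k v != x -> i != j -> i != k -> j = k.
Proof.
move=> xi xj xk ij ik; apply/eqP; apply: contraT => jk.
have [l xl] := x_level.
have eK a : row a v != x -> evec R a \in Ksh P.
  move=> xa; apply: evec_Ksh => q Kq t lt; apply: contra xa => ta.
  exact/eqP/(x_support Kq lt).
have neq_l a : row a v != x -> l == a = false.
  by move=> xa; apply: contraNF xa => /eqP<-; rewrite xl.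
pose X := [tuple ones R n; evec R i; evec R j; evec R k].
have frX : free X.
  apply/freeP => m; rewrite !big_ord_recl big_ord0 addr0 => /colP E.
  have Ea a : m ord0 + m (lift ord0 ord0) * (a == i)%:R
      + m (lift ord0 (lift ord0 ord0)) * (a == j)%:R
      + m (lift ord0 (lift ord0 (lift ord0 ord0))) * (a == k)%:R = 0.
    by have := E a; rewrite !mxE !eqxx !andbT mulr1 !addrA.
  (* At the point [l] of the level set only the vector of ones is nonzero. *)
  have m0 : m ord0 = 0 by have := Ea l; rewrite !neq_l // !mulr0 !addr0.
  move: Ea; rewrite m0 => Ea; case=> -[|[|[|[|//]]]] lt_m.
  - by rewrite -[RHS]m0; congr m; exact/val_inj.
  - have := Ea i; rewrite eqxx (negPf ij) (negPf ik) !mulr0 !addr0 mulr1 add0r.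
    by move<-; congr m; exact/val_inj.
  - have := Ea j; rewrite eqxx eq_sym (negPf ij) (negPf jk).
    rewrite !mulr0 addr0 mulr1 !add0r.
    by move<-; congr m; exact/val_inj.
  - have := Ea k; rewrite eqxx eq_sym (negPf ik) eq_sym (negPf jk).
    rewrite !mulr0 mulr1 !add0r.
    by move<-; congr m; exact/val_inj.
have : (<<X>> <= Ksh P)%VS.
  apply/span_subvP => y; rewrite !inE => /or4P[] /eqP->; rewrite ?eK //.
  exact: ones_Ksh.
by move=> /dimvS; rewrite (eqP frX) dimK.
Qed.

(** At most two points lie outside the level, so [v] is not constant on [t], and exactly one other
    vertex [k] is outside. The displacement is parallel to the edge opposite [i]. *)
Lemma tight_outside t i : tight P t -> in_triple t i -> row i v != x ->
  exists j k N,
  [/\ [/\ in_triple t j, in_triple t k & row j v = x],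
      row k v != x /\ i != k,
      [/\ linear_on t P v N, \tr N = 0, \tr (N *m M) = 0 & N != 0]
    & Ddet t (replace_pt P i (row i P + (row j P - row k P))) = Ddet t P].
Proof.
move=> tt it xi; have [N [lin trN trNM]] := ell_tight ell tt.
have [b [c [[tb tc bc] ib ic rep]]] := Ddet_replace R it.
have ncst : ~ constant_on t v.
  move=> cst; move/eqP: bc; apply; apply: (at_most_two_outside xi) => //.
    by rewrite (cst b i).
  by rewrite (cst c i).
have N0 : N != 0.
  apply: contra_notN ncst => /eqP N0 a a' ta ta'; apply: subr0_eq.
  by rewrite lin // N0 mulmx0.
have inj := linear_on_constant tt lin trN trNM.
have [xb|xb] := eqVneq (row b v) x.
  exists b, c, N; split=> //; last by rewrite rep !mxE; ring.
  split=> //; apply: contra_notN ncst => /eqP xc.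
  by apply: (inj b c) => //; rewrite xb.
exists c, b, N; split=> //; last by rewrite rep !mxE; ring.
split=> //; apply/eqP; apply: contraT => xc.
by rewrite (at_most_two_outside xi xb xc ib ic) eqxx in bc.
Qed.

Lemma outside_not_pinned i : maximizers P -> row i v != x ->
  ~ vertex (one_point_polyhedron P i) (row i P, Delta R n).
Proof.
move=> P_max xi pin.
have off c : ~ on_side (P i c) by move=> /x_side E; rewrite E eqxx in xi.
have frozen (z : 'rV[R]_2) : (forall t, tight P t -> in_triple t i ->
    Ddet t (replace_pt P i (row i P + z)) = Ddet t P) -> z = 0.
  move=> zD; apply: (pinned_direction (s := 0) P_max pin) => [c /off//|t tt].
  rewrite addr0 /sarea; congr (_ * _).
  have [it|it] := boolP (in_triple t i); first exact: zD.
  exact: Ddet_replace_notin.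
have [[t [tt it]]|none] := pselect (exists t, tight P t /\ in_triple t i); last first.
  have /rowP/(_ 0)/eqP : vec2 1 0 = 0 :> 'rV[R]_2.
    by apply: frozen => t tt it; case: none; exists t.
  by rewrite !mxE oner_eq0.
have [j [k [N [[tj tk xj] [xk ik] [lin trN trNM N0] Dz]]]] := tight_outside tt it xi.
have /frozen/eqP : forall t', tight P t' -> in_triple t' i ->
    Ddet t' (replace_pt P i (row i P + (row j P - row k P))) = Ddet t' P.
  move=> t' tt' it'.
  have [j' [k' [N' [[tj' tk' xj'] [xk' ik'] [lin' trN' trNM' N0'] Dz']]]] :=
    tight_outside tt' it' xi.
  have kk' := at_most_two_outside xi xk xk' ik ik'.
  suff -> : row j P = row j' P by rewrite kk'.
  subst k'; have PkPi : row k P - row i P != 0.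
    rewrite subr_eq0; apply: contra_neq ik => E; apply/esym.
    exact: (triple_vertices_inj (tight_Ddet Delta0 tt) tk it E).
  (* [N] and [N'] agree on the nonzero vector from [p_i] to [p_k], while [N - N'] satisfies the same
     trace conditions and so is 0 or invertible. *)
  have NN' : N = N'.
    apply/eqP; rewrite -subr_eq0; apply: contraNT PkPi => NN'.
    have uNN' : N - N' \in unitmx.
      rewrite unitmxE unitfE lt_eqF // (det_trace_orth (ell_disc ell)) //.
        by rewrite linearB /= trN trN' subrr.
      by rewrite mulmxBl linearB /= trNM trNM' subrr.
    by rewrite -[X in X == _](mulmxK uNN') mulmxBr -lin // -lin' // subrr mul0mx.
  have uN : N \in unitmx.
    by rewrite unitmxE unitfE lt_eqF // (det_trace_orth (ell_disc ell)).
  (* Inverting [N] recovers [p_j - p_i] from [x - row i v], which is the same for both triangles. *)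
  apply: (addIr (- row i P)); rewrite -[LHS](mulmxK uN) -[RHS](mulmxK uN).
  by rewrite -lin // {2}NN' -lin' // xj xj'.
rewrite subr_eq0 => /eqP/(triple_vertices_inj (tight_Ddet Delta0 tt) tj tk) E.
by rewrite -E xj eqxx in xk.
Qed.

End EllipticPencil.

Theorem theorem6p12 (R : realType) (n : nat) (n_ge3 : (3 <= n)%N)
    (P : 'M[R]_(n, 2)) (P_max : maximizers P) (P_pinned : fully_pinned P)
    (W_nodec : forall (h : vquot <[ones R n]>%VS) (u : 'rV[R]_2),
       h \in H0 P -> tensor h u \in W P -> tensor h u = 0) :
  ~ (\dim (H0 P) = 2%N /\ \dim (W P) = 2%N).
Proof.
move=> [dimH0 dimW]; have Delta0 := Delta_gt0 R n_ge3.
have t0 := some_triple n_ge3; have i0 := ti t0.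
have [v [M ell]] := elliptic_exists i0 Delta0 dimH0 dimW W_nodec.
have [a [b ab]] := ell_nonconstant ell.
have dimK : \dim (Ksh P) = 3%N by rewrite (dim_Ksh P i0) dimH0.
have [K_neq0|K0] := pselect (exists q, KKT P q).
  have [x [x_level x_side x_support]] := support_level Delta0 ell K_neq0.
  have out i : row i v != x -> False.
    move=> xi; apply: (outside_not_pinned Delta0 ell x_side x_support) (P_pinned i) => //.
  have [E|/out//] := eqVneq (row a v) x.
  by move: ab; rewrite E eq_sym => /out.
have n3 : n = 3%N.
  (* An intersection over the empty family of multipliers is the whole space. *)
  have KE : Ksh P = fullv.
    apply/vspaceP => h; rewrite memvf; apply/mem_Ksh => q Kq.
    by case: K0; exists q.
  by rewrite KE dimvf /dim /= muln1 in dimK.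
have one_triple t : t = t0.
  have [/andP[ij jk] /andP[ij0 jk0]] := (triple_ltn t, triple_ltn t0).
  have [lt lt0] := (ltn_ord (tk t), ltn_ord (tk t0)).
  have [ei ej ek] : [/\ ti t = ti t0, tj t = tj t0 & tk t = tk t0].
    by split; apply: val_inj => /=; lia.
  apply: val_inj; move: ei ej ek; rewrite /ti /tj /tk.
  by case: (val t) (val t0) => [[? ?] ?] [[? ?] ?] /= -> -> ->.
(* The only area changes at some rate [s] along a free coordinate direction, which
   [pinned_direction] allows for. *)
have corner i c : on_side (P i c).
  apply: contraT => off.
  pose z : 'rV[R]_2 := delta_mx 0 c.
  pose s := sarea P t0 (replace_pt P i (row i P + z)) - sarea P t0 P.
  suff /rowP/(_ c)/eqP : z = 0 by rewrite !mxE !eqxx oner_eq0.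
  apply: (pinned_direction (s := s) P_max (P_pinned i)) => [c' sc|t _].
    by rewrite mxE /=; have [E|//] := eqVneq c' c; rewrite -E sc in off.
  by rewrite (one_triple t) [RHS]addrC subrK.
by move/eqP: ab; apply; exact: (ell_side ell (corner a 0) (corner b 0)).
Qed.
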